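(* Let $S\subset\mathbb{R}^n$ be a surface of class $C^3$ with band $B(S)$ (as in the context). Let $A:S\to\mathbb{R}^{n\times n}$ be a $C^1$ tensor field that maps all vectors to tangent vectors, i.e. $A(y)\xi\in\mathcal{T}_yS$ for all $y\in S$ and all $\xi\in\mathbb{R}^n$. Let $\operatorname{cp}:B(S)\to S$ be any $C^2$-smooth closest point function. Then for every $u\in C^2(S)$, $$\operatorname{div}_S\left(A\nabla_Su\right)(y)=\operatorname{div}\left((A\circ\operatorname{cp})\,\nabla[u\circ\operatorname{cp}]\right)(y)\qquad\text{for all } y\in S,$$ where $\operatorname{div}$ and $\nabla$ are the ordinary divergence and gradient in $\mathbb{R}^n$, applied to functions on $B(S)$.
   Context: Surfaces. $S$ is an embedded submanifold of $\mathbb{R}^n$ (here of class $C^3$) without boundary (if there is a boundary, $S$ is identified with its interior), of dimension $k\le n$, possessing a tubular neighborhood $B(S)\subset\mathbb{R}^n$, an open set containing $S$, called a band around $S$. $S$ is orientable in the sense that, if $k<n$, there are smooth unit vector fields $N_1,\dots,N_{n-k}:S\to\mathbb{R}^n$ spanning the normal space $\mathcal{N}_yS$ at each $y\in S$. $\mathcal{T}_yS$ is the tangent space, and $P(y)\in\mathbb{R}^{n\times n}$ is the orthogonal projector of $\mathbb{R}^n$ onto $\mathcal{T}_yS$. Surface differential operators. For a $C^1$ surface function and a point $y\in S$, let the subscript $E$ denote any $C^1$ extension to an open set of $\mathbb{R}^n$ containing $y$ (agreeing with the given function on the part of $S$ in this open set). For $u:S\to\mathbb{R}$, $\nabla_Su(y)^T:=\nabla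 u_E(y)^T\cdot P(y)$; for $g:S\to\mathbb{R}^n$ (not necessarily tangential), $\operatorname{div}_Sg(y):=\operatorname{trace}(Dg_E(y)\cdot P(y))$. These are independent of the chosen extension. Closest point function. A map $\operatorname{cp}:B(S)\to S$ is a closest point function if (1) it is a $C^1$-retraction, i.e. $\operatorname{cp}$ is continuously differentiable (as a map into $\mathbb{R}^n$) and $\operatorname{cp}(y)=y$ for all $y\in S$; and (2) its Jacobian satisfies $D\operatorname{cp}(y)=P(y)$ for all $y\in S$. *)

(* Defs.v *)
From HB Require Import structures.
From mathcomp Require Export all_boot all_order all_algebra.
From mathcomp Require Export all_classical all_reals all_analysis.

Set Implicit Arguments.
Unset Strict Implicit.
Unset Printing Implicit Defensive.

Import Order.TTheory GRing.Theory Num.Theory.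
Export numFieldNormedType.Exports.

Local Open Scope classical_set_scope.
Local Open Scope ring_scope.

(* Points and vectors of R^n are column vectors.  Functions that the
   mathematics defines only on S, on the band, or on an open set are total
   functions here, of which only the values on that set are ever used. *)

(** * Calculus in R^n *)

(* f is of class C^r on the open set U: in finite dimension, x |-> 'd f x is
   C^r iff x |-> 'd f x v is C^r for every vector v. *)
Fixpoint class_C (R : realType) (V W : normedModType R) (r : nat)
    (U : set V) (f : V -> W) : Prop :=
  match r with
  | 0 => forall x, U x -> {for x, continuous f}
  | r'.+1 => (forall x, U x -> differentiable f x) /\
             (forall v, class_C r' U (fun x => 'd f x v))
  end.

(* The library's jacobian acts on row vectors by right multiplication; this is
   its transpose, with entries (d f_i / d x_j)(y). *)
Definition jac (R : realType) (n m : nat) (f : 'cV[R]_n -> 'cV[R]_m)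
    (y : 'cV[R]_n) : 'M[R]_(m, n) :=
  \matrix_(i, j) 'd f y (delta_mx j 0) i 0.

Definition grad (R : realType) (n : nat) (u : 'cV[R]_n -> R) (y : 'cV[R]_n) :
    'cV[R]_n :=
  \col_j 'd u y (delta_mx j 0).

Definition div (R : realType) (n : nat) (g : 'cV[R]_n -> 'cV[R]_n)
    (y : 'cV[R]_n) : R :=
  \tr (jac g y).

Definition dotv (R : realType) (n : nat) (v w : 'cV[R]_n) : R :=
  \sum_i v i 0 * w i 0.

(* The norm `|v| of the library is the sup norm. *)
Definition enorm (R : realType) (n : nat) (v : 'cV[R]_n) : R :=
  Num.sqrt (dotv v v).

(** * Surfaces *)

Definition diffeo (R : realType) (n r : nat) (U V : set 'cV[R]_n)
    (Phi Psi : 'cV[R]_n -> 'cV[R]_n) : Prop :=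
  [/\ open U /\ open V,
      class_C r U Phi /\ class_C r V Psi,
      (forall x, U x -> V (Phi x) /\ Psi (Phi x) = x)
    & (forall z, V z -> U (Psi z) /\ Phi (Psi z) = z)].

(* S is an embedded k-dimensional submanifold of class C^r, without boundary:
   near each of its points a C^r diffeomorphism carries S to R^k x {0}. *)
Definition embedded_submanifold (R : realType) (n r k : nat)
    (S : set 'cV[R]_n) : Prop :=
  (k <= n)%N /\
  forall y, S y -> exists U V Phi Psi,
    [/\ U y, diffeo r U V Phi Psi
      & forall x, U x ->
          (S x <-> forall i : 'I_n, (k <= i)%N -> Phi x i 0 = 0)].

(* T_y S: velocities at y of the C^1 curves in S. *)
Definition tangent_space (R : realType) (n : nat) (S : set 'cV[R]_n)
    (y : 'cV[R]_n) : set 'cV[R]_n :=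
  [set v | exists (c : R -> 'cV[R]_n) (e : R),
    [/\ 0 < e, class_C 1 [set t : R | `|t| < e] c,
        (forall t, `|t| < e -> S (c t)), c 0 = y & 'D_1 c 0 = v]].

Definition normal_space (R : realType) (n : nat) (S : set 'cV[R]_n)
    (y : 'cV[R]_n) : set 'cV[R]_n :=
  [set w | forall v, tangent_space S y v -> dotv v w = 0].

Definition orthogonal_projector (R : realType) (n : nat) (T : set 'cV[R]_n)
    (P : 'M[R]_n) : Prop :=
  [/\ P *m P = P, P^T = P & T = range (fun v : 'cV[R]_n => P *m v)].

(* P(y), the orthogonal projector onto T_y S; such a matrix is unique, and it
   exists as soon as y lies on an embedded submanifold S of class C^1. *)
Definition tangent_proj (R : realType) (n : nat) (S : set 'cV[R]_n)
    (y : 'cV[R]_n) : 'M[R]_n :=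
  xget 0 [set P | orthogonal_projector (tangent_space S y) P].

(* g is a C^r extension of the surface function f to an open set around y. *)
Definition surface_extension (R : realType) (n : nat) (W : normedModType R)
    (r : nat) (S : set 'cV[R]_n) (y : 'cV[R]_n) (f g : 'cV[R]_n -> W) : Prop :=
  exists U : set 'cV[R]_n,
    [/\ open U, U y, class_C r U g & forall x, S x -> U x -> g x = f x].

Definition surface_class_C (R : realType) (n : nat) (W : normedModType R)
    (r : nat) (S : set 'cV[R]_n) (f : 'cV[R]_n -> W) : Prop :=
  forall y, S y -> exists g, surface_extension r S y f g.

(* On a surface of class C^r, "smooth" fields of normal vectors are fields of
   class C^(r-1), the best regularity available in general. *)
Definition orientable (R : realType) (n r k : nat) (S : set 'cV[R]_n) : Prop :=
  (k < n)%N ->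
  exists N : 'I_(n - k) -> 'cV[R]_n -> 'cV[R]_n,
    (forall i, surface_class_C r.-1 S (N i)) /\
    forall y, S y ->
      (forall i, enorm (N i y) = 1) /\
      normal_space S y =
        range (fun a : 'I_(n - k) -> R => \sum_i a i *: N i y).

(* B is a tubular neighborhood of S: for some continuous delta > 0 on S, the
   map (y, w) |-> y + w is a diffeomorphism from
   {(y, w) | y in S, w in N_y S, |w| < delta y} onto the open set B.  Its
   inverse is x |-> (pi x, x - pi x); the normal bundle of a C^r surface is of
   class C^(r-1), hence so is the diffeomorphism. *)
Definition tubular_neighborhood (R : realType) (n r : nat)
    (S B : set 'cV[R]_n) : Prop :=
  [/\ open B, S `<=` B
    & exists (delta : 'cV[R]_n -> R) (pi : 'cV[R]_n -> 'cV[R]_n),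
      [/\ {within S, continuous delta} /\ (forall y, S y -> 0 < delta y),
          class_C r.-1 B pi,
          (forall x, B x ->
             [/\ S (pi x), normal_space S (pi x) (x - pi x)
               & enorm (x - pi x) < delta (pi x)])
        & (forall y w, S y -> normal_space S y w -> enorm w < delta y ->
             B (y + w) /\ pi (y + w) = y)]].

(* S is a k-dimensional surface of class C^r with band B. *)
Definition surface_with_band (R : realType) (n r k : nat)
    (S B : set 'cV[R]_n) : Prop :=
  [/\ embedded_submanifold r k S, orientable r k S
    & tubular_neighborhood r S B].

(** * Surface differential operators *)

(* A C^1 extension of f around y; the operators below do not depend on which
   one is chosen. *)
Definition extend (R : realType) (n : nat) (W : normedModType R)
    (S : set 'cV[R]_n) (y : 'cV[R]_n) (f : 'cV[R]_n -> W) : 'cV[R]_n -> W :=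
  xget f [set g | surface_extension 1 S y f g].

Definition surface_grad (R : realType) (n : nat) (S : set 'cV[R]_n)
    (u : 'cV[R]_n -> R) (y : 'cV[R]_n) : 'cV[R]_n :=
  ((grad (extend S y u) y)^T *m tangent_proj S y)^T.

Definition surface_div (R : realType) (n : nat) (S : set 'cV[R]_n)
    (g : 'cV[R]_n -> 'cV[R]_n) (y : 'cV[R]_n) : R :=
  \tr (jac (extend S y g) y *m tangent_proj S y).

(** * Closest point functions *)

Definition closest_point_function (R : realType) (n : nat)
    (S B : set 'cV[R]_n) (cp : 'cV[R]_n -> 'cV[R]_n) : Prop :=
  [/\ (forall x, B x -> S (cp x)), class_C 1 B cp,
      (forall y, S y -> cp y = y)
    & (forall y, S y -> jac cp y = tangent_proj S y)].

(* Main.v *)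
Require Import Defs.

(** Write [v := u \o cp].  By the chain rule and [jac cp = P] on [S], the surface
    gradient of [u] is the restriction of [grad v] to [S], so that any [C^1]
    extension [H] of the flux [A grad_S u] satisfies
    [(H \o cp) x = A (cp x) *m grad v (cp x)] near [y].  Hence the surface
    divergence of the flux is the divergence at [y] of the right-hand side.
    Replacing [grad v (cp x)] by [grad v x] changes the Jacobian at [y] by
    [A *m D2v *m (1 - P)], whose trace vanishes because [P *m A = A]: [cp] fixes
    the curves drawn on [S], so its differential fixes their velocities. *)

Set Implicit Arguments.
Unset Strict Implicit.
Unset Printing Implicit Defensive.

Import Order.TTheory GRing.Theory Num.Theory.
Local Open Scope classical_set_scope.
Local Open Scope ring_scope.

(** * Locality of continuity and of the differential *)

(** The first-order expansion of [f] at [x] is also one of [g], and a continuous linear term in such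
    an expansion is unique. *)
Lemma near_eq_diff (R : realType) (V W : normedModType R) (f g : V -> W)
    (x : V) :
  {near x, f =1 g} -> differentiable f x ->
  differentiable g x /\ 'd g x = 'd f x :> (V -> W).
Proof.
move=> fg df; have fgx : f x = g x by exact: nbhs_singleton fg.
have dfc : continuous ('d f x) by exact: diff_continuous.
have gE : g \o shift x = cst (g x) + 'd f x +o_ 0 id.
  apply/eqaddoP => e e0.
  move/diff_locally/eqaddoP : df => /(_ e e0) fe.
  have fg0 : \forall h \near 0, f (h + x) = g (h + x).
    have := fg; rewrite [\forall y \near x, _](near_shift 0) /=.
    by apply: filterS => h /=; rewrite subr0.
  near=> h.
  have <- : (f \o shift x - (cst (f x) + 'd f x)) h =
            (g \o shift x - (cst (g x) + 'd f x)) h.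
    by rewrite ![(_ - _) h]/(_ - _) -fgx /=; congr (_ - _); near: h.
  by near: h.
have dg : 'd g x = 'd f x :> (V -> W) by exact: diff_unique.
by split => //; apply/diff_locallyP; rewrite dg.
Unshelve. all: by end_near. Qed.

Lemma near_eq_continuous (T U : topologicalType) (f g : T -> U) (x : T) :
  {near x, f =1 g} -> {for x, continuous f} -> {for x, continuous g}.
Proof.
move=> fg cf; rewrite /prop_for /continuous_at -(nbhs_singleton fg).
by apply: cvg_trans cf; apply: near_eq_cvg.
Qed.

(** * Entrywise calculus of matrix-valued maps *)

Lemma is_diff_coord (R : realType) (V : normedModType R) (m n : nat)
    (f : V -> 'M[R]_(m, n)) (x : V) i j :
  differentiable f x -> is_diff x (fun z => f z i j) (fun v => 'd f x v i j).
Proof.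
move=> df.
(* The entry map is bundled as a linear map, so that it is its own differential. *)
have @c : {linear 'M[R]_(m, n) -> R}.
  by exists (fun N : 'M[R]_(_, _) => N i j); do 2![eexists]; do ?[constructor];
     rewrite ?mxE// => ? *; rewrite ?mxE//; move=> ?; rewrite !mxE.
have cc : continuous c by exact: coord_continuous.
have dc : differentiable c (f x) by exact: linear_differentiable.
have -> : (fun z => f z i j) = c \o f by [].
apply: DiffDef; first exact: differentiable_comp.
by rewrite diff_comp // diff_lin.
Qed.

Lemma is_diff_fun_sum (R : realType) (V W : normedModType R) (n : nat)
    (f : 'I_n -> V -> W) (x : V) :
  (forall i, differentiable (f i) x) ->
  is_diff x (fun z => \sum_i f i z) (fun v => \sum_i 'd (f i) x v).
Proof.
elim: n f => [|n IHn] f df.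
  have -> : (fun z => \sum_i f i z) = cst 0.
    by apply/funext => z; rewrite big_ord0.
  by apply: is_diff_eq; apply/funext => v; rewrite big_ord0.
have -> : (fun z => \sum_i f i z) =
    f ord0 + (fun z => \sum_i f (lift ord0 i) z).
  by apply/funext => z; rewrite big_ord_recl.
have d0 := differentiableP (df ord0).
have d1 := IHn (fun i => f (lift ord0 i)) (fun i => df _).
by apply: is_diff_eq; apply/funext => v; rewrite big_ord_recl.
Qed.

Lemma differentiable_fun_sum (R : realType) (V W : normedModType R) (n : nat)
    (f : 'I_n -> V -> W) (x : V) :
  (forall i, differentiable (f i) x) ->
  differentiable (fun z => \sum_i f i z) x.
Proof. by case/is_diff_fun_sum. Qed.

(** Reduces regularity of a matrix-valued map to that of its entries: each summand is a scalar
    function times a constant matrix. *)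
Lemma mx_funE (T : Type) (R : realType) (m n : nat) (f : T -> 'M[R]_(m, n)) :
  f = fun z => \sum_i \sum_j f z i j *: delta_mx i j.
Proof. by apply/funext => z; rewrite -matrix_sum_delta. Qed.

Lemma differentiable_mx (R : realType) (V : normedModType R) (m n : nat)
    (f : V -> 'M[R]_(m, n)) (x : V) :
  (forall i j, differentiable (fun z => f z i j) x) -> differentiable f x.
Proof.
move=> df; rewrite [f]mx_funE.
apply: differentiable_fun_sum => i; apply: differentiable_fun_sum => j.
exact: differentiableZl.
Qed.

Lemma continuous_fun_sum (R : realType) (T : topologicalType)
    (W : normedModType R) (n : nat) (f : 'I_n -> T -> W) (x : T) :
  (forall i, {for x, continuous (f i)}) ->
  {for x, continuous (fun z => \sum_i f i z)}.
Proof.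
move=> cf; rewrite /prop_for /continuous_at.
elim: n f cf => [|n IHn] f cf.
  rewrite big_ord0 (_ : (fun z => _) = cst 0); first exact: cvg_cst.
  by apply/funext => z; rewrite big_ord0.
rewrite big_ord_recl (_ : (fun z => _) =
    f ord0 \+ (fun z => \sum_i f (lift ord0 i) z)).
  by apply: cvgD; [exact: cf | apply: IHn].
by apply/funext => z; rewrite big_ord_recl.
Qed.

Lemma continuous_mx (R : realType) (T : topologicalType) (m n : nat)
    (f : T -> 'M[R]_(m, n)) (x : T) :
  (forall i j, {for x, continuous (fun z => f z i j)}) ->
  {for x, continuous f}.
Proof.
move=> cf; rewrite [f]mx_funE.
apply: continuous_fun_sum => i; apply: continuous_fun_sum => j.
by apply: cvgZr_tmp; exact: cf.
Qed.

(** * Maps of class C^1 on an open set *)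

(** As [U] is open, ['d f] agrees with the explicit formula [df] near each point of [U], so
    continuity transfers from the formula. *)
Lemma class_C1P (R : realType) (V W : normedModType R) (U : set V)
    (f : V -> W) (df : V -> V -> W) :
  open U -> (forall x, U x -> is_diff x f (df x)) ->
  (forall v, class_C 0 U (df ^~ v)) -> class_C 1 U f.
Proof.
move=> oU fdf cdf; split=> [x Ux|v x Ux]; first by have [] := fdf _ Ux.
apply: near_eq_continuous (cdf v x Ux).
have : \forall z \near x, U z by exact: open_nbhs_nbhs.
by apply: filterS => z Uz; have [_ ->] := fdf _ Uz.
Qed.

Lemma class_C1_diff (R : realType) (V W : normedModType R) (U : set V)
    (f : V -> W) (x : V) :
  class_C 1 U f -> U x -> differentiable f x.
Proof. by case=> + _; apply. Qed.

Lemma class_C1_coord (R : realType) (V : normedModType R) (m n : nat)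
    (U : set V) (f : V -> 'M[R]_(m, n)) i j :
  open U -> class_C 1 U f -> class_C 1 U (fun z => f z i j).
Proof.
move=> oU [df cdf]; apply: class_C1P => // [x Ux|v x Ux].
  exact: is_diff_coord (df _ Ux).
apply: (@continuous_comp _ _ _ (fun z => 'd f z v) (fun N => N i j)).
  exact: cdf.
exact: coord_continuous.
Qed.

Lemma class_C1_mx (R : realType) (V : normedModType R) (m n : nat)
    (U : set V) (f : V -> 'M[R]_(m, n)) :
  open U -> (forall i j, class_C 1 U (fun z => f z i j)) -> class_C 1 U f.
Proof.
move=> oU cf.
have df x : U x -> differentiable f x.
  by move=> Ux; apply: differentiable_mx => i j; exact: class_C1_diff (cf i j) Ux.
split=> // v x Ux; apply: continuous_mx => i j.
apply: near_eq_continuous ((cf i j).2 v x Ux).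
have : \forall z \near x, U z by exact: open_nbhs_nbhs.
by apply: filterS => z Uz; have [_ ->] := is_diff_coord i j (df z Uz).
Qed.

Lemma class_C1M (R : realType) (V : normedModType R) (U : set V)
    (f g : V -> R) :
  open U -> class_C 1 U f -> class_C 1 U g ->
  class_C 1 U (fun z => f z * g z).
Proof.
move=> oU cf cg.
apply: (@class_C1P _ _ _ _ _ (fun x v => f x * 'd g x v + g x * 'd f x v)) => //.
  move=> x Ux; have df := differentiableP (class_C1_diff cf Ux).
  by have dg := differentiableP (class_C1_diff cg Ux); exact: is_diffM.
move=> v x Ux.
have cfx : {for x, continuous f}.
  exact/differentiable_continuous/(class_C1_diff cf Ux).
have cgx : {for x, continuous g}.
  exact/differentiable_continuous/(class_C1_diff cg Ux).
by apply: cvgD; apply: cvgM => //; [exact: cg.2 | exact: cf.2].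
Qed.

Lemma class_C1_sum (R : realType) (V W : normedModType R) (n : nat)
    (U : set V) (f : 'I_n -> V -> W) :
  open U -> (forall i, class_C 1 U (f i)) ->
  class_C 1 U (fun z => \sum_i f i z).
Proof.
move=> oU cf; apply: class_C1P => // [x Ux|v x Ux].
  by apply: is_diff_fun_sum => i; exact: class_C1_diff (cf i) Ux.
by apply: continuous_fun_sum => i; exact: (cf i).2.
Qed.

Lemma class_C1_mulmx (R : realType) (V : normedModType R) (m n p : nat)
    (U : set V) (f : V -> 'M[R]_(m, n)) (g : V -> 'M[R]_(n, p)) :
  open U -> class_C 1 U f -> class_C 1 U g ->
  class_C 1 U (fun z => f z *m g z).
Proof.
move=> oU cf cg; apply: class_C1_mx => // i j.
rewrite (_ : (fun z => _) = fun z => \sum_l f z i l * g z l j); last first.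
  by apply/funext => z; rewrite mxE.
by apply: class_C1_sum => // l; apply: class_C1M => //; exact: class_C1_coord.
Qed.

Lemma is_diff_mulmx (R : realType) (V : normedModType R) (m n p : nat)
    (f : V -> 'M[R]_(m, n)) (g : V -> 'M[R]_(n, p)) (x : V) :
  differentiable f x -> differentiable g x ->
  is_diff x (fun z => f z *m g z)
    (fun v => f x *m 'd g x v + 'd f x v *m g x).
Proof.
move=> df dg.
have dfg i j : is_diff x (fun z => (f z *m g z) i j)
    (fun v => \sum_l (f x i l * 'd g x v l j + 'd f x v i l * g x l j)).
  have dl l : is_diff x (fun z => f z i l * g z l j)
      (fun v => f x i l * 'd g x v l j + 'd f x v i l * g x l j).
    have di := is_diff_coord i l df; have dj := is_diff_coord l j dg.
    apply: (@is_diff_eq _ _ _ _ _ _ _ (is_diffM di dj)).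
    by apply/funext => v; rewrite [_ * g x l j]mulrC.
  rewrite (_ : (fun z => _) = fun z => \sum_l f z i l * g z l j); last first.
    by apply/funext => z; rewrite mxE.
  have dl' l : differentiable (fun z => f z i l * g z l j) x by have [] := dl l.
  apply: (@is_diff_eq _ _ _ _ _ _ _ (is_diff_fun_sum dl')).
  by apply/funext => v; apply: eq_bigr => l _; have [_ ->] := dl l.
have d : differentiable (fun z => f z *m g z) x.
  by apply: differentiable_mx => i j; have [] := dfg i j.
(* The entries of the differential are the differentials of the entries, which [dfg] computes. *)
apply: DiffDef => //; apply/funext => v; apply/matrixP => i j.
have [_ /(congr1 (@^~ v)) <-] := is_diff_coord i j d.
have [_ ->] := dfg i j.
by rewrite !mxE -big_split.
Qed.

(** * Jacobians, gradients and their chain rules *)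

Lemma mul_jac (R : realType) (n m : nat) (f : 'cV[R]_n -> 'cV[R]_m)
    (y v : 'cV[R]_n) : jac f y *m v = 'd f y v.
Proof.
have vE : v = \sum_j v j 0 *: delta_mx j 0.
  by rewrite [LHS]matrix_sum_delta; apply: eq_bigr => j _; rewrite big_ord1.
apply/matrixP => i k; rewrite ord1 [in RHS]vE linear_sum summxE mxE.
by apply: eq_bigr => j _; rewrite linearZ !mxE mulrC.
Qed.

Lemma jac_eq (R : realType) (n m : nat) (f g : 'cV[R]_n -> 'cV[R]_m)
    (x y : 'cV[R]_n) :
  'd f x = 'd g y :> ('cV[R]_n -> 'cV[R]_m) -> jac f x = jac g y.
Proof.
by move/(congr1 (fun d : 'cV[R]_n -> 'cV[R]_m =>
  \matrix_(i, j) d (delta_mx j 0) i 0)).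
Qed.

Lemma jac_comp (R : realType) (n m p : nat) (f : 'cV[R]_n -> 'cV[R]_m)
    (g : 'cV[R]_m -> 'cV[R]_p) (y : 'cV[R]_n) :
  differentiable f y -> differentiable g (f y) ->
  jac (g \o f) y = jac g (f y) *m jac f y.
Proof.
move=> df dg; apply/matrixP => i j; rewrite [LHS]mxE [RHS]mxE diff_comp //=.
by rewrite -mul_jac mxE; apply: eq_bigr => l _; rewrite [jac f y l j]mxE.
Qed.

(** Gradients are columns, so the row form of the chain rule appears transposed. *)
Lemma grad_comp (R : realType) (n m : nat) (f : 'cV[R]_n -> 'cV[R]_m)
    (u : 'cV[R]_m -> R) (y : 'cV[R]_n) :
  differentiable f y -> differentiable u (f y) ->
  grad (u \o f) y = (jac f y)^T *m grad u (f y).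
Proof.
move=> df du; apply/matrixP => j k; rewrite ord1 [LHS]mxE diff_comp //=.
set v := 'd f y _.
have vE : v = \sum_j v j 0 *: delta_mx j 0.
  by rewrite [LHS]matrix_sum_delta; apply: eq_bigr => l _; rewrite big_ord1.
rewrite vE linear_sum [RHS]mxE; apply: eq_bigr => l _.
by rewrite linearZ !mxE.
Qed.

Lemma grad_near_eq (R : realType) (n : nat) (u v : 'cV[R]_n -> R)
    (y : 'cV[R]_n) :
  {near y, u =1 v} -> differentiable u y -> grad v y = grad u y.
Proof.
move=> uv du; have [_ dvu] := near_eq_diff uv du.
by apply/matrixP => j k; rewrite !mxE dvu.
Qed.

(** * Regularity of restrictions, Jacobians and gradients *)

Lemma class_C_le1 (R : realType) (V W : normedModType R) (U : set V)
    (f : V -> W) : class_C 2 U f -> class_C 1 U f.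
Proof.
case=> df cdf; split=> // v x Ux.
exact/differentiable_continuous/(class_C1_diff (cdf v) Ux).
Qed.

Lemma class_C_subset (R : realType) (V W : normedModType R) (r : nat)
    (U U' : set V) (f : V -> W) :
  U `<=` U' -> class_C r U' f -> class_C r U f.
Proof.
move=> UU'; elim: r f => [|r IHr] f /=; first by move=> cf x /UU' /cf.
by move=> [df cdf]; split=> [x /UU' /df //|v]; apply: IHr.
Qed.

Lemma class_C1_jac_tr (R : realType) (n m : nat) (U : set 'cV[R]_n)
    (f : 'cV[R]_n -> 'cV[R]_m) :
  open U -> class_C 2 U f -> class_C 1 U (fun x => (jac f x)^T).
Proof.
move=> oU [_ cdf]; apply: class_C1_mx => // j i.
rewrite (_ : (fun z => _) = fun z => 'd f z (delta_mx j 0) i 0).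
  exact: class_C1_coord.
by apply/funext => z; rewrite !mxE.
Qed.

Lemma class_C1_grad (R : realType) (n : nat) (U : set 'cV[R]_n)
    (u : 'cV[R]_n -> R) :
  open U -> class_C 2 U u -> class_C 1 U (grad u).
Proof.
move=> oU [_ cdu]; apply: class_C1_mx => // j k.
rewrite (_ : (fun z => _) = fun z => 'd u z (delta_mx j 0)) //.
by apply/funext => z; rewrite !mxE.
Qed.

(** * Surface extensions and composition with [cp] *)

Lemma surface_extension_le1 (R : realType) (n : nat) (W : normedModType R)
    (S : set 'cV[R]_n) (y : 'cV[R]_n) (f g : 'cV[R]_n -> W) :
  surface_extension 2 S y f g -> surface_extension 1 S y f g.
Proof. by case=> U [oU Uy /class_C_le1 cg gf]; exists U. Qed.

(** The choice made by [extend] is meaningful once some C^1 extension exists; [g] serves as that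
    witness. *)
Lemma extendP (R : realType) (n : nat) (W : normedModType R)
    (S : set 'cV[R]_n) (y : 'cV[R]_n) (f g : 'cV[R]_n -> W) :
  surface_extension 1 S y f g -> surface_extension 1 S y f (extend S y f).
Proof.
by move=> fg; apply: (@xgetPex _ f [set g | surface_extension 1 S y f g]);
  exists g.
Qed.

Lemma surface_extension_diff (R : realType) (n : nat) (W : normedModType R)
    (S : set 'cV[R]_n) (y : 'cV[R]_n) (f g : 'cV[R]_n -> W) :
  surface_extension 1 S y f g -> differentiable g y.
Proof. by case=> U [_ Uy cg _]; exact: class_C1_diff cg Uy. Qed.

Lemma near_retraction (R : realType) (n : nat) (S B U : set 'cV[R]_n)
    (cp : 'cV[R]_n -> 'cV[R]_n) (y : 'cV[R]_n) :
  open B -> S `<=` B -> closest_point_function S B cp -> S y ->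
  open U -> U y -> \forall x \near y, [/\ B x, S (cp x) & U (cp x)].
Proof.
move=> oB SB [cpS [dcp _] cpy _] Sy oU Uy.
have By : \forall x \near y, B x.
  by apply: open_nbhs_nbhs; split => //; exact: SB.
(* Continuity of [cp] at [y], together with [cp y = y]. *)
have Ucp : \forall x \near y, U (cp x).
  have /differentiable_continuous := dcp y (SB _ Sy); apply.
  by rewrite cpy //; exact: open_nbhs_nbhs.
by apply: filterS2 By Ucp => x Bx Ux; split => //; exact: cpS.
Qed.

(** [cp] takes its values in [S], where every extension agrees with [f]; the choice of extension
    thus disappears after composition. *)
Lemma surface_extension_comp (R : realType) (n : nat) (W : normedModType R)
    (S B : set 'cV[R]_n) (cp : 'cV[R]_n -> 'cV[R]_n) (y : 'cV[R]_n)
    (f g : 'cV[R]_n -> W) :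
  open B -> S `<=` B -> closest_point_function S B cp -> S y ->
  surface_extension 1 S y f g -> {near y, g \o cp =1 f \o cp}.
Proof.
move=> oB SB hcp Sy [U [oU Uy _ gf]].
apply: filterS (near_retraction oB SB hcp Sy oU Uy) => x [_ Sx Ux] /=.
exact: gf.
Qed.

(** With [e] the chosen extension, [u \o cp] equals [e \o cp] near [y], and the chain rule with
    [jac cp y = P] gives [P^T *m grad e y], which is [surface_grad] with its transposes expanded. *)
Lemma surface_gradE (R : realType) (n : nat) (S B : set 'cV[R]_n)
    (cp : 'cV[R]_n -> 'cV[R]_n) (u g : 'cV[R]_n -> R) (y : 'cV[R]_n) :
  open B -> S `<=` B -> closest_point_function S B cp -> S y ->
  surface_extension 1 S y u g ->
  surface_grad S u y = grad (u \o cp) y.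
Proof.
move=> oB SB hcp Sy ug; have [_ [dcp _] cpy jcp] := hcp.
have dcpy := dcp y (SB _ Sy).
have eg := extendP ug.
have de : differentiable (extend S y u) (cp y).
  by rewrite cpy //; exact: surface_extension_diff eg.
rewrite (grad_near_eq (surface_extension_comp oB SB hcp Sy eg)); last first.
  exact: differentiable_comp.
by rewrite grad_comp // cpy // /surface_grad trmx_mul trmxK jcp.
Qed.

(** For a curve [c] in [S] with velocity [v], [cp \o c] is [c] near 0; differentiating both sides at
    0 gives the claim. *)
Lemma diff_retraction_tangent (R : realType) (n : nat) (S : set 'cV[R]_n)
    (cp : 'cV[R]_n -> 'cV[R]_n) (y v : 'cV[R]_n) :
  differentiable cp y -> (forall x, S x -> cp x = x) ->
  tangent_space S y v -> 'd cp y v = v.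
Proof.
move=> dcp cpS [c [e [e0 [dc _] cS c0 cv]]]; subst y.
have dc0 : differentiable c 0 by apply: dc; rewrite /= normr0.
have near_c : {near 0, c =1 cp \o c}.
  have : \forall t \near (0 : R), `|t| < e.
    apply/nbhs_ballP; exists e => //= t; rewrite -ball_normE /=.
    by rewrite sub0r normrN.
  by apply: filterS => t te /=; rewrite cpS //; exact: cS.
have [_ dcpc] := near_eq_diff near_c dc0.
have -> : v = 'd c 0 1 by rewrite -cv; exact: deriveE.
exact: (congr1 (fun d : R -> 'cV[R]_n => d 1)
  (etrans (esym (diff_comp dc0 dcp)) dcpc)).
Qed.

(** * Divergence of a matrix field applied to a vector field *)

(** The Leibniz rule, arranged so that the term differentiating [M] sees [w] only through [w y];
    this term is the same for [w] and [w \o cp] when [cp y = y]. *)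
Lemma jac_mulmx (R : realType) (n m p : nat) (M : 'cV[R]_n -> 'M[R]_(m, p))
    (w : 'cV[R]_n -> 'cV[R]_p) (y : 'cV[R]_n) :
  differentiable M y -> differentiable w y ->
  jac (fun x => M x *m w x) y =
  M y *m jac w y + \matrix_(i, j) ('d M y (delta_mx j 0) *m w y) i 0.
Proof.
move=> dM dw; have [_ dMw] := is_diff_mulmx dM dw.
apply/matrixP => i j; rewrite mxE dMw !mxE; congr (_ + _).
by apply: eq_bigr => l _; rewrite mxE.
Qed.

(* The two Jacobians at [y] are [M *m jac w *m P + X] and [M *m jac w + X] with
   [P := jac cp y]; their traces agree by cyclicity, since [P *m M y = M y]. *)
Lemma div_comp_retraction (R : realType) (n : nat)
    (cp : 'cV[R]_n -> 'cV[R]_n) (M : 'cV[R]_n -> 'M[R]_n)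
    (w : 'cV[R]_n -> 'cV[R]_n) (y : 'cV[R]_n) :
  differentiable cp y -> cp y = y -> differentiable M y ->
  differentiable w y -> (forall xi, 'd cp y (M y *m xi) = M y *m xi) ->
  div (fun x => M x *m w (cp x)) y = div (fun x => M x *m w x) y.
Proof.
move=> dcp cpy dM dw Mtan.
have dwcpy : differentiable w (cp y) by rewrite cpy.
have dwcp : differentiable (w \o cp) y by exact: differentiable_comp.
have jacM : jac cp y *m M y = M y.
  (* Column by column, from [Mtan] at the standard basis vectors. *)
  apply/matrixP => i j.
  have := Mtan (delta_mx j 0); rewrite -mul_jac mulmxA -!colE.
  by move/matrixP => /(_ i 0); rewrite !mxE.
rewrite /div (jac_mulmx dM dw) (jac_mulmx dM dwcp) jac_comp //= cpy.
rewrite [LHS]mxtraceD [RHS]mxtraceD; congr (_ + _).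
move: (jac cp y) (jac w y) (M y) jacM => P J N PN.
by rewrite mulmxA (mxtrace_mulC (N *m J) P) mulmxA PN.
Qed.

(** * The divergence identity on the surface *)

Theorem theorem4p2 (R : realType) (n k : nat) (S B : set 'cV[R]_n)
    (hS : surface_with_band 3 k S B)
    (A : 'cV[R]_n -> 'M[R]_n)
    (hA : surface_class_C 1 S A)
    (hAtan : forall y, S y -> forall xi : 'cV[R]_n,
       tangent_space S y (A y *m xi))
    (cp : 'cV[R]_n -> 'cV[R]_n)
    (hcp : closest_point_function S B cp)
    (hcp2 : class_C 2 B cp)
    (u : 'cV[R]_n -> R)
    (hu : surface_class_C 2 S u) :
  forall y, S y ->
    surface_div S (fun x => A x *m surface_grad S u x) y =
    div (fun x => A (cp x) *m grad (u \o cp) x) y.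
Proof.
move=> y Sy.
have [_ _ [oB SB _]] := hS.
have [cpS [dcp _] cpid jcp] := hcp.
have By := SB _ Sy; have dcpy := dcp y By; have cpy := cpid y Sy.
have surf_gradE x : S x -> surface_grad S u x = grad (u \o cp) x.
  move=> Sx; have [g /surface_extension_le1 ug] := hu x Sx.
  exact: surface_gradE oB SB hcp Sx ug.
have [g ug2] := hu y Sy; have ug := surface_extension_le1 ug2.
have [Ug [oUg Ugy cg2 gu]] := ug2; have cg := class_C_le1 cg2.
have [AE hAE] := hA y Sy; have [UA [oUA UAy cAE AEA]] := hAE.
(* Off [S] the values of [u] are arbitrary, so regularity of [grad (u \o cp)] is read off the C^2
   extension [g]. *)
have gradE x : B x -> Ug (cp x) -> {near x, g \o cp =1 u \o cp} ->
    grad (u \o cp) x = (jac cp x)^T *m grad g (cp x).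
  move=> Bx Ux gux.
  have dgx := class_C1_diff cg Ux; have dcpx := dcp x Bx.
  have dgcp := differentiable_comp dcpx dgx.
  exact: etrans (grad_near_eq gux dgcp) (grad_comp dcpx dgx).
(* [extend] can be used for the flux only once a C^1 extension is exhibited. The witness is the
   formula of [gradE] with [cp x] replaced by [x], which is legitimate on [S]. *)
have [G hG] : exists G,
    surface_extension 1 S y (fun x => A x *m surface_grad S u x) G.
  pose U := Ug `&` UA `&` B.
  have oU : open U by apply: openI => //; exact: openI.
  exists (fun x => AE x *m ((jac cp x)^T *m grad g x)); exists U; split => //.
    apply: class_C1_mulmx => //.
      by apply: class_C_subset cAE => x [[]].
    apply: class_C1_mulmx => //.
      by apply: class_C1_jac_tr => //; apply: class_C_subset hcp2 => x [].
    by apply: class_C1_grad => //; apply: class_C_subset cg2 => x [[]].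
  move=> x Sx [[Ugx UAx] Bx]; rewrite AEA // surf_gradE // gradE ?cpid //.
  (* On the same open set [Ug], [g] also extends [u] around the other points [x] of [S]. *)
  by apply: (surface_extension_comp oB SB hcp Sx); exists Ug.
have hH := extendP hG; set H := extend S y _ in hH *.
have dH : differentiable H (cp y).
  by rewrite cpy; exact: surface_extension_diff hH.
(* The projector in the surface divergence is absorbed as the inner factor of a chain rule. *)
have jacHcp : jac (H \o cp) y = jac H y *m tangent_proj S y.
  by rewrite (jac_comp dcpy dH) cpy (jcp y Sy).
rewrite /surface_div -/H -jacHcp.
have HE : {near y, H \o cp =1 (fun x => A (cp x) *m grad (u \o cp) (cp x))}.
  apply: filterS2 (surface_extension_comp oB SB hcp Sy hH)
    (near_retraction oB SB hcp Sy oB By) => x /= -> [_ Sx _].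
  by rewrite surf_gradE.
have [_ dHE] := near_eq_diff HE (differentiable_comp dcpy dH).
rewrite -(jac_eq dHE).
(* [A] itself is controlled only on [S], but [A \o cp] coincides near [y] with the differentiable
   map [AE \o cp]. *)
have dA : differentiable (A \o cp) y.
  have dAE : differentiable AE (cp y).
    by rewrite cpy; exact: surface_extension_diff hAE.
  have nA := surface_extension_comp oB SB hcp Sy hAE.
  by have [] := near_eq_diff nA (differentiable_comp dcpy dAE).
have dgrad : differentiable (grad (u \o cp)) y.
  have gradE_near : {near y, (fun x => (jac cp x)^T *m grad g (cp x)) =1
      grad (u \o cp)}.
    (* Comparing gradients at [x] requires [g \o cp] and [u \o cp] to agree around [x], for every
       [x] close to [y]. *)
    have /near_join := surface_extension_comp oB SB hcp Sy ug.
    apply: filterS2 (near_retraction oB SB hcp Sy oUg Ugy) => x [Bx _ Ux] gux.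
    exact: esym (gradE _ Bx Ux gux).
  have dj := class_C1_diff (class_C1_jac_tr oB hcp2) By.
  have dg : differentiable (grad g) (cp y).
    by rewrite cpy; exact: class_C1_diff (class_C1_grad oUg cg2) Ugy.
  have [dp _] := is_diff_mulmx dj (differentiable_comp dcpy dg).
  by have [] := near_eq_diff gradE_near dp.
(* Used with [M := A \o cp] and [w := grad (u \o cp)]; what remains is that ['d cp y] fixes the
   range of [A y], which consists of tangent vectors. *)
apply: (div_comp_retraction dcpy cpy dA dgrad) => xi.
apply: diff_retraction_tangent dcpy cpid _.
by rewrite /= cpy; exact: hAtan.
Qed.
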